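(* Let $\mathbf{J}=-\mathbf{J}^T\in\mathbb{R}^{N,N}$, let $\mathbf{R}=\mathbf{R}^T\in\mathbb{R}^{N,N}$ be positive semi-definite, $\mathbf{B}_i\in\mathbb{R}^{n_i,m}$ for $i=1,2,3$, $N=n_1+n_2+n_3$, and let the Hamiltonian be quadratic, $$H(z_1,z_2)=\tfrac12\langle z_1,\mathbf{M}_1z_1\rangle+\tfrac12\langle z_2,\mathbf{M}_2z_2\rangle,$$ with symmetric matrices $\mathbf{M}_1\in\mathbb{R}^{n_1,n_1}$, $\mathbf{M}_2\in\mathbb{R}^{n_2,n_2}$. Let $\tau>0$ be the step size and set $H^n=H(z_1^n,z_2^n)$. Then the midpoint scheme $$\begin{bmatrix}\tau\,\partial_{z_1}H^{n+1/2}\\ z_2^{n+1}-z_2^n\\ 0\end{bmatrix}=(\mathbf{J}-\mathbf{R})\begin{bmatrix}z_1^{n+1}-z_1^n\\ \tau\,\partial_{z_2}H^{n+1/2}\\ \tau z_3^{n+1/2}\end{bmatrix}+\tau\begin{bmatrix}\mathbf{B}_1\\ \mathbf{B}_2\\ \mathbf{B}_3\end{bmatrix}u^{n+1/2},$$ $$\tau y^{n+1/2}=\begin{bmatrix}\mathbf{B}_1^T&\mathbf{B}_2^T&\mathbf{B}_3^T\end{bmatrix}\begin{bmatrix}z_1^{n+1}-z_1^n\\ \tau\,\partial_{z_2}H^{n+1/2}\\ \tau z_3^{n+1/2}\end{bmatrix}$$ satisfies $$H^{n+1}-H^n\le\tau\,\langle y^{n+1/2},u^{n+1/2}\rangle$$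 and, in particular, $H^{n+1}\le H^n$ for vanishing inputs.
   Context: The scheme is the midpoint time discretization of the system $[\partial_{z_1}H;\dot z_2;0]=(\mathbf{J}-\mathbf{R})[\dot z_1;\partial_{z_2}H;z_3]+[\mathbf{B}_1;\mathbf{B}_2;\mathbf{B}_3]u$, $y=[\mathbf{B}_1^T\ \mathbf{B}_2^T\ \mathbf{B}_3^T][\dot z_1;\partial_{z_2}H;z_3]$ with state $z=[z_1;z_2;z_3]\in\mathbb{R}^{n_1+n_2+n_3}$ and $\mathbb{R}^m$-valued input $u$ and output $y$, on equidistant time points $t^n=n\tau$. $z_j^n\in\mathbb{R}^{n_j}$ denotes the approximation of $z_j(t^n)$; $x^{n+1/2}=\tfrac12(x^n+x^{n+1})$ for $x=z_3$ and for $x=\partial_{z_k}H$ (so $\partial_{z_k}H^{n+1/2}=\tfrac12\mathbf{M}_k(z_k^n+z_k^{n+1})$, $k=1,2$); $u^{n+1/2}=u(t^n+\tau/2)\in\mathbb{R}^m$; and $y^{n+1/2}\in\mathbb{R}^m$ is defined by the second equation of the scheme. $\langle x,y\rangle=x^Ty$ is the Euclidean inner product, $[x;y]$ denotes vertical stacking. *)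

(* Defs.v *)
From mathcomp Require Import all_boot all_order all_algebra.
From mathcomp Require Import all_classical all_reals all_analysis.
Import Order.TTheory GRing.Theory Num.Theory.
Import numFieldNormedType.Exports.

Set Implicit Arguments.
Unset Strict Implicit.
Unset Printing Implicit Defensive.

Local Open Scope ring_scope.

Definition dotcv (R : realType) (k : nat) (x y : 'cV[R]_k) : R :=
  (x^T *m y) 0 0.

Definition psdmx (R : realType) (k : nat) (A : 'M[R]_k) : Prop :=
  forall x : 'cV[R]_k, 0 <= dotcv x (A *m x).

Definition gradcv (R : realType) (k : nat) (f : 'cV[R]_k -> R)
    (x : 'cV[R]_k) : 'cV[R]_k :=
  \col_i 'D_(delta_mx i 0) f x.

Definition hamiltonian (R : realType) (n1 n2 : nat)
    (M1 : 'M[R]_n1) (M2 : 'M[R]_n2) (z1 : 'cV[R]_n1) (z2 : 'cV[R]_n2) : R :=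
  2^-1 * dotcv z1 (M1 *m z1) + 2^-1 * dotcv z2 (M2 *m z2).

Definition gradH1 (R : realType) (n1 n2 : nat)
    (H : 'cV[R]_n1 -> 'cV[R]_n2 -> R) (z1 : 'cV[R]_n1) (z2 : 'cV[R]_n2) :
  'cV[R]_n1 := gradcv (fun x => H x z2) z1.

Definition gradH2 (R : realType) (n1 n2 : nat)
    (H : 'cV[R]_n1 -> 'cV[R]_n2 -> R) (z1 : 'cV[R]_n1) (z2 : 'cV[R]_n2) :
  'cV[R]_n2 := gradcv (fun x => H z1 x) z2.

Definition stack3 (R : realType) (n1 n2 n3 k : nat)
    (X1 : 'M[R]_(n1, k)) (X2 : 'M[R]_(n2, k)) (X3 : 'M[R]_(n3, k)) :
  'M[R]_(n1 + n2 + n3, k) := col_mx (col_mx X1 X2) X3.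

(* x^{n+1/2} for a quantity given at the time points *)
Definition half (R : realType) (k : nat) (x : nat -> 'cV[R]_k) (n : nat) :
  'cV[R]_k := 2^-1 *: (x n + x n.+1).

(* u^{n+1/2}: a point evaluation of u, not an average of its values at t^n and
   t^{n+1} *)
Definition uhalf (R : realType) (m : nat) (tau : R) (u : R -> 'cV[R]_m)
    (n : nat) : 'cV[R]_m := u (n%:R * tau + tau / 2).

(* The n-th step of the scheme; [y n] stands for y^{n+1/2}. *)
Definition midpoint_step (R : realType) (n1 n2 n3 m : nat)
    (J D : 'M[R]_(n1 + n2 + n3))
    (B1 : 'M[R]_(n1, m)) (B2 : 'M[R]_(n2, m)) (B3 : 'M[R]_(n3, m))
    (H : 'cV[R]_n1 -> 'cV[R]_n2 -> R) (tau : R) (u : R -> 'cV[R]_m)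
    (z1 : nat -> 'cV[R]_n1) (z2 : nat -> 'cV[R]_n2) (z3 : nat -> 'cV[R]_n3)
    (y : nat -> 'cV[R]_m) (n : nat) : Prop :=
  let dH1 := half (fun k => gradH1 H (z1 k) (z2 k)) n in
  let dH2 := half (fun k => gradH2 H (z1 k) (z2 k)) n in
  let w := stack3 (z1 n.+1 - z1 n) (tau *: dH2) (tau *: half z3 n) in
  stack3 (tau *: dH1) (z2 n.+1 - z2 n) 0
    = (J - D) *m w + tau *: (stack3 B1 B2 B3 *m uhalf tau u n)
  /\ tau *: y n = row_mx (row_mx B1^T B2^T) B3^T *m w.

(* Main.v *)
(* The midpoint rule telescopes a quadratic energy exactly: the increment of H
   over one step is <dz1, dH1> + <dH2, dz2>, with midpoint gradients.  Testing
   the scheme with w = [dz1; tau dH2; tau z3] gives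
   tau (H^{n+1} - H^n) = <w, (J - D) w> + tau <B^T w, u>, where B^T w = tau y
   by the output equation, the J-term vanishes by skew symmetry, and the D-term
   has a sign. *)
Require Import Defs.
From mathcomp Require Import all_boot all_order all_algebra.
From mathcomp Require Import all_classical all_reals all_analysis.
From mathcomp Require Import ring lra.
Import Order.TTheory GRing.Theory Num.Theory.
Import numFieldNormedType.Exports.

Set Implicit Arguments.
Unset Strict Implicit.
Unset Printing Implicit Defensive.

Local Open Scope ring_scope.

Section BilinearForm.
Variables (R : realType) (k : nat).
Implicit Types (x y z : 'cV[R]_k) (a : R) (A : 'M[R]_k).

Lemma dotcvC x y : dotcv x y = dotcv y x.
Proof. by rewrite /dotcv -[in RHS](trmxK x) -trmx_mul [RHS]mxE. Qed.

Lemma dotcvDl x y z : dotcv (x + y) z = dotcv x z + dotcv y z.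
Proof. by rewrite /dotcv linearD mulmxDl mxE. Qed.

Lemma dotcvDr x y z : dotcv x (y + z) = dotcv x y + dotcv x z.
Proof. by rewrite /dotcv mulmxDr mxE. Qed.

Lemma dotcvNl x y : dotcv (- x) y = - dotcv x y.
Proof. by rewrite /dotcv linearN mulNmx mxE. Qed.

Lemma dotcvNr x y : dotcv x (- y) = - dotcv x y.
Proof. by rewrite /dotcv mulmxN mxE. Qed.

Lemma dotcvZl a x y : dotcv (a *: x) y = a * dotcv x y.
Proof. by rewrite /dotcv linearZ -scalemxAl mxE. Qed.

Lemma dotcvZr a x y : dotcv x (a *: y) = a * dotcv x y.
Proof. by rewrite /dotcv -scalemxAr mxE. Qed.

Lemma dotcv0r x : dotcv x 0 = 0.
Proof. by rewrite /dotcv mulmx0 mxE. Qed.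

Lemma dotcv_delta_mx (i : 'I_k) x : dotcv (delta_mx i 0) x = x i 0.
Proof. by rewrite /dotcv trmx_delta -rowE mxE. Qed.

Lemma dotcv_mulmx_sym A x y : A = A^T -> dotcv x (A *m y) = dotcv y (A *m x).
Proof. by move=> As; rewrite dotcvC /dotcv trmx_mul -As mulmxA. Qed.

(** A scalar equals its own transpose, so skew symmetry makes the form equal to its negative. *)
Lemma dotcv_mulmx_skew A x : A = - A^T -> dotcv x (A *m x) = 0.
Proof.
move=> Ask; have : dotcv x (A *m x) = - dotcv x (A *m x).
  rewrite {1}dotcvC -dotcvNr -mulNmx [in RHS]Ask opprK.
  by rewrite /dotcv trmx_mul mulmxA.
by move=> e; lra.
Qed.

End BilinearForm.

Lemma dotcv_mulmx (R : realType) (k m : nat) (B : 'M[R]_(k, m))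
    (x : 'cV[R]_k) (u : 'cV[R]_m) :
  dotcv x (B *m u) = dotcv (B^T *m x) u.
Proof. by rewrite /dotcv trmx_mul trmxK mulmxA. Qed.

Lemma dotcv_stack3 (R : realType) (n1 n2 n3 : nat)
    (x1 y1 : 'cV[R]_n1) (x2 y2 : 'cV[R]_n2) (x3 y3 : 'cV[R]_n3) :
  dotcv (stack3 x1 x2 x3) (stack3 y1 y2 y3)
    = dotcv x1 y1 + dotcv x2 y2 + dotcv x3 y3.
Proof. by rewrite /dotcv /stack3 !tr_col_mx !mul_row_col !mxE. Qed.

Lemma tr_stack3 (R : realType) (n1 n2 n3 m : nat)
    (B1 : 'M[R]_(n1, m)) (B2 : 'M[R]_(n2, m)) (B3 : 'M[R]_(n3, m)) :
  (stack3 B1 B2 B3)^T = row_mx (row_mx B1^T B2^T) B3^T.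
Proof. by rewrite /stack3 !tr_col_mx. Qed.

(** Along the line through [x] in direction [v], the difference quotient is [a + h * b] for
    [h != 0]. Gradients are thus read off as linear coefficients of an exact expansion. *)
Lemma derive_of_quadratic_expansion (R : realType) (V : normedModType R)
    (f : V -> R) (x v : V) (a b : R) :
  (forall h : R, f (h *: v + x) = f x + h * a + h ^+ 2 * b) -> 'D_v f x = a.
Proof.
move=> fE; apply: cvg_lim => //.
have : ((fun h : R => a + h * b) @ 0^' --> a + 0 * b)%classic.
  apply: cvgD; first exact: cvg_cst.
  by apply: cvgMl; exact: nbhs_dnbhs.
(* The quotient only has to agree with [a + h * b] on a punctured neighbourhood of 0, where [h] can
   be cancelled. *)
rewrite mul0r addr0; apply: cvg_trans; apply: near_eq_cvg.
near=> h.
have h0 : h != 0 by near: h; exact: nbhs_dnbhs_neq.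
transitivity (h^-1 * (f (h *: v + x) - f x)); last by [].
by rewrite fE; field.
Unshelve. all: by end_near. Qed.

(** Symmetry of [M] merges the two cross terms, each of weight one half, into the single linear term
    in [h]. *)
Lemma quadratic_form_expansion (R : realType) (k : nat) (M : 'M[R]_k)
    (x v : 'cV[R]_k) (h : R) :
  M = M^T ->
  2^-1 * dotcv (h *: v + x) (M *m (h *: v + x))
    = 2^-1 * dotcv x (M *m x) + h * dotcv v (M *m x)
      + h ^+ 2 * (2^-1 * dotcv v (M *m v)).
Proof.
move=> Ms; rewrite mulmxDr -scalemxAr !(dotcvDl, dotcvDr, dotcvZl, dotcvZr).
by rewrite (dotcv_mulmx_sym x v Ms); field.
Qed.

Section QuadraticHamiltonian.
Variables (R : realType) (n1 n2 : nat) (M1 : 'M[R]_n1) (M2 : 'M[R]_n2).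
Hypotheses (M1_sym : M1 = M1^T) (M2_sym : M2 = M2^T).

Lemma gradH1_hamiltonian z1 z2 : gradH1 (hamiltonian M1 M2) z1 z2 = M1 *m z1.
Proof.
(* Writing the [i]-th entry as a pairing with [delta_mx i 0] gives it the shape of the linear
   coefficient in that direction. *)
apply/matrixP => i j; rewrite ord1 mxE -dotcv_delta_mx.
apply: derive_of_quadratic_expansion => h.
by rewrite /hamiltonian quadratic_form_expansion// addrAC (addrAC _ (h * _)).
Qed.

Lemma gradH2_hamiltonian z1 z2 : gradH2 (hamiltonian M1 M2) z1 z2 = M2 *m z2.
Proof.
apply/matrixP => i j; rewrite ord1 mxE -dotcv_delta_mx.
apply: derive_of_quadratic_expansion => h.
by rewrite /hamiltonian quadratic_form_expansion// !addrA.
Qed.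

(** This is the difference of two squares for a symmetric form. The second pairing has the gradient
    first because the test vector of the scheme carries the gradient in its second block. *)
Lemma hamiltonian_increment (z1 : nat -> 'cV[R]_n1) (z2 : nat -> 'cV[R]_n2) n :
  let H := hamiltonian M1 M2 in
  H (z1 n.+1) (z2 n.+1) - H (z1 n) (z2 n)
    = dotcv (z1 n.+1 - z1 n) (Defs.half (fun k => gradH1 H (z1 k) (z2 k)) n)
      + dotcv (Defs.half (fun k => gradH2 H (z1 k) (z2 k)) n) (z2 n.+1 - z2 n).
Proof.
rewrite /= /Defs.half !gradH1_hamiltonian !gradH2_hamiltonian /hamiltonian.
rewrite [X in _ = _ + X]dotcvC !(dotcvDl, dotcvZr, dotcvDr, dotcvNl).
(* By symmetry the mixed terms between old and new states cancel. *)
rewrite (dotcv_mulmx_sym (z1 n.+1) (z1 n))//.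
rewrite (dotcv_mulmx_sym (z2 n.+1) (z2 n))//.
by field.
Qed.

End QuadraticHamiltonian.

Theorem lemma2p7 (R : realType) (n1 n2 n3 m : nat)
  (J D : 'M[R]_(n1 + n2 + n3))
  (B1 : 'M[R]_(n1, m)) (B2 : 'M[R]_(n2, m)) (B3 : 'M[R]_(n3, m))
  (M1 : 'M[R]_n1) (M2 : 'M[R]_n2)
  (tau : R) (u : R -> 'cV[R]_m)
  (z1 : nat -> 'cV[R]_n1) (z2 : nat -> 'cV[R]_n2) (z3 : nat -> 'cV[R]_n3)
  (y : nat -> 'cV[R]_m)
  (J_skew : J = - J^T) (D_sym : D = D^T) (D_psd : psdmx D)
  (M1_sym : M1 = M1^T) (M2_sym : M2 = M2^T)
  (tau_gt0 : 0 < tau) :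
  let H := hamiltonian M1 M2 in
  let Hn := fun k : nat => H (z1 k) (z2 k) in
  forall n : nat,
    midpoint_step J D B1 B2 B3 H tau u z1 z2 z3 y n ->
    Hn n.+1 - Hn n <= tau * dotcv (y n) (uhalf tau u n)
    /\ (uhalf tau u n = 0 -> Hn n.+1 <= Hn n).
Proof.
move=> H Hn n [scheme output].
set un := uhalf tau u n in scheme output *.
set w := stack3 (z1 n.+1 - z1 n) _ _ in scheme output.
(* In the supply term one [tau] comes from the scaled input of the scheme, the other from the output
   equation, which determines [tau *: y n]. *)
have balance : tau * (Hn n.+1 - Hn n)
    = - dotcv w (D *m w) + tau * (tau * dotcv (y n) un).
  rewrite -(dotcvZl tau (y n)) output -tr_stack3 -dotcv_mulmx -dotcvZr.
  have -> : - dotcv w (D *m w) = dotcv w ((J - D) *m w).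
    by rewrite mulmxBl dotcvDr dotcvNr (dotcv_mulmx_skew w J_skew) add0r.
  (* The right-hand side is now [w] paired with the right side of the scheme. On its left side the
     third block is zero, so [z3] drops out. *)
  rewrite -dotcvDr -scheme dotcv_stack3 dotcv0r addr0 dotcvZr dotcvZl -mulrDr.
  by rewrite hamiltonian_increment.
have dissipation : Hn n.+1 - Hn n <= tau * dotcv (y n) un.
  by rewrite -(ler_pM2l tau_gt0) balance gerDr oppr_le0; exact: D_psd.
split=> // un0.
by move: dissipation; rewrite un0 dotcv0r mulr0 subr_le0.
Qed.
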